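(* Let $S$ be a ring and $R$ a subring of $S$ which is an integral domain contained in the center of $S$. Let $S$ be a free $R$-module of finite rank $n$ which is additively generated by its invertible elements. Let $G'$ be a subgroup of $\operatorname{GL}(n,R)$, put $T'=T\cap G'$, and assume that every element of $\overline{T}$ is a $\overline{k}$-linear combination of elements of the connected component (of the identity) of $\overline{T'}$. Then $$N_{G'}(T')=\bigl(T\rtimes \operatorname{Aut}(S/R)\bigr)\cap G',$$ where $T\rtimes \operatorname{Aut}(S/R)\leqslant\operatorname{GL}(n,R)$ is the semidirect product of the normal subgroup $T$ and the group $\operatorname{Aut}(S/R)$ of all ring automorphisms of $S$ that are the identity on $R$.
   Context: Rings are associative with unit, subrings are unitary. Fix an $R$-basis $\omega_1,\dots,\omega_n$ of $S$. For $\alpha\in S$ let $t(\alpha)=(t_{ij}(\alpha))\in M(n,R)$ be the matrix of right multiplication by $\alpha$: $\omega_i\alpha=\sum_{j=1}^n t_{ji}(\alpha)\omega_j$. Put $T=t(S^* )\leqslant\operatorname{GL}(n,R)$. Let $k$ be the quotient field of $R$ and $\overline{k}$ its algebraic closure. For a subgroup $X\leqslant \operatorname{GL}(n,\overline{k})$, $\overline{X}$ denotes its Zariski closure in $\operatorname{GL}(n,\overline{k})$. $\operatorname{Aut}(S/R)$ is regarded as a subgroup of $\operatorname{GL}(n,R)$ by sending an automorphism to its matrix (as an $R$-linear map) in the basis $\omega_1,\dots,\omega_n$ (the $i$-th column being the coordinates of the image of $\omega_i$). $N_{G'}(\cdot)$ is the normalizer in $G'$. *)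

(* Defs.v *)
From HB Require Import structures.
From mathcomp Require Import all_boot all_order all_algebra.
From mathcomp Require Import boolp classical_sets topology.
From mathcomp Require Import -(notations) mpoly.

Set Implicit Arguments.
Unset Strict Implicit.
Unset Printing Implicit Defensive.

Import GRing.Theory.
Local Open Scope classical_set_scope.
Local Open Scope ring_scope.

(* Synonym of 'M[K]_n carrying the Zariski topology of the affine space K^(n*n):
   the closed sets are the zero loci of families of polynomials in the
   matrix entries. *)
Definition zmatrix (K : fieldType) (n : nat) : Type := 'M[K]_n.

HB.instance Definition _ (K : fieldType) (n : nat) :=
  Choice.on (zmatrix K n).

Section Zariski.
Variables (K : fieldType) (n : nat).

Definition eval_entries (p : mpoly (n * n) K) (A : 'M[K]_n) : K :=
  meval (fun i => mxvec A 0 i) p.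

Definition zero_locus (P : set (mpoly (n * n) K)) : set (zmatrix K n) :=
  [set A | forall p, P p -> eval_entries p A = 0].

Definition zariski_open (U : set (zmatrix K n)) : Prop :=
  exists P, ~` U = zero_locus P.

Lemma zariski_openT : zariski_open setT.
Proof.
exists [set p | p = 1]; rewrite setCT; apply/seteqP; split=> A //= /(_ 1 erefl).
rewrite /eval_entries meval1 => /eqP.
by rewrite oner_eq0.
Qed.

Lemma zariski_openI : setI_closed zariski_open.
Proof.
move=> U V [P UP] [Q VQ].
exists [set r | exists p q, [/\ P p, Q q & r = p * q]].
rewrite setCI UP VQ; apply/seteqP; split=> A.
  move=> ZA r [p [q [Pp Qq ->]]]; rewrite /eval_entries mevalM.
  case: ZA => [/(_ p Pp)|/(_ q Qq)]; rewrite /eval_entries => ->.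
    by rewrite mul0r.
  by rewrite mulr0.
move=> ZA; have [ZPA|] := pselect (zero_locus P A); first by left.
move=> /existsNP [p /not_implyP [Pp pA]]; right => q Qq.
have := ZA _ (ex_intro _ p (ex_intro _ q (And3 Pp Qq erefl))).
rewrite /eval_entries mevalM => /eqP; rewrite mulf_eq0.
by case/orP => /eqP // /pA.
Qed.

Lemma zariski_open_bigU (I : Type) (U : I -> set (zmatrix K n)) :
  (forall i, zariski_open (U i)) -> zariski_open (\bigcup_i U i).
Proof.
move=> oU; exists [set p | exists i P, ~` U i = zero_locus P /\ P p].
rewrite setC_bigcup; apply/seteqP; split=> A.
  by move=> UA p [i [P [UP Pp]]]; have := UA i Logic.I; rewrite UP; apply.
move=> ZA i _; have [P UP] := oU i; rewrite UP => p Pp.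
by apply: ZA; exists i, P.
Qed.

HB.instance Definition _ := @isOpenTopological.Build (zmatrix K n)
  zariski_open zariski_openT zariski_openI zariski_open_bigU.

(* GL(n, K) is a principal open subset of K^(n*n), so its own Zariski topology
   (polynomials in the entries and 1/det) is the subspace topology. *)
Definition zariski_closure_GL (X : set 'M[K]_n) : set 'M[K]_n :=
  @closure (zmatrix K n) X `&` [set A | A \in unitmx].

Definition identity_component (X : set 'M[K]_n) : set 'M[K]_n :=
  @connected_component (zmatrix K n) X 1%:M.

End Zariski.

Definition lincomb (K : fieldType) (V : lmodType K) (X : set V) : set V :=
  [set v | exists (m : nat) (c : 'I_m -> K) (x : 'I_m -> V),
     (forall i, X (x i)) /\ v = \sum_i c i *: x i].

Definition is_algebraic_closure (k : fieldType) (K : closedFieldType)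
    (iota : {rmorphism k -> K}) : Prop :=
  forall x : K, algebraicOver iota x.

Section MatrixGroups.
Variables (R : comUnitRingType) (n : nat).
Implicit Types (X Y : set 'M[R]_n).

Definition is_subgroup_GL X : Prop :=
  [/\ forall A, X A -> A \in unitmx,
      X 1%:M,
      forall A B, X A -> X B -> X (A *m B)
    & forall A, X A -> X (invmx A)].

Definition conj_set (g : 'M[R]_n) X : set 'M[R]_n :=
  [set g *m x *m invmx g | x in X].

Definition normalizer_in X Y : set 'M[R]_n :=
  [set g | X g /\ conj_set g Y = Y].

Definition prod_set X Y : set 'M[R]_n :=
  [set A | exists x y, [/\ X x, Y y & A = x *m y]].

(* The product set X Y is an internal semidirect product X ><| Y. *)
Definition is_semidirect X Y : Prop :=
  [/\ is_subgroup_GL X, is_subgroup_GL Y,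
      forall y, Y y -> conj_set y X = X
    & X `&` Y = [set 1%:M]].

End MatrixGroups.

Section Algebra.
Variables (R : idomainType) (S : unitAlgType R) (n : nat).
Variable omega : 'I_n -> S.

Definition is_free_basis : Prop :=
  forall x : S, exists! c : 'rV[R]_n, x = \sum_i c 0 i *: omega i.

Definition unit_generated : Prop :=
  forall A : set S,
    A 0 -> (forall x y, A x -> A y -> A (x - y)) ->
    (forall u, u \is a GRing.unit -> A u) ->
    forall x, A x.

(* The coordinates of the images of the basis are the columns of A. *)
Definition is_matrix_of (f : S -> S) (A : 'M[R]_n) : Prop :=
  forall i, f (omega i) = \sum_j A j i *: omega j.

Definition unit_mult_mx : set 'M[R]_n :=
  [set A | exists2 alpha : S, alpha \is a GRing.unit &
     is_matrix_of (fun x => x * alpha) A].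

Definition aut_mx : set 'M[R]_n :=
  [set A | exists phi : {rmorphism S -> S},
     [/\ bijective phi, forall r : R, phi r%:A = r%:A & is_matrix_of phi A]].

End Algebra.

(* Main.v *)
Require Import Defs.
From HB Require Import structures.
From mathcomp Require Import all_boot all_order all_algebra.
From mathcomp Require Import boolp classical_sets topology.
From mathcomp Require Import -(notations) mpoly.

Set Implicit Arguments.
Unset Strict Implicit.
Unset Printing Implicit Defensive.

Import GRing.Theory.
Local Open Scope classical_set_scope.
Local Open Scope ring_scope.

(** Identify a matrix with the endomorphism of the free module S that it
represents. An endomorphism commuting with all left multiplications of S is the
right multiplication by the image of 1, so T consists of the invertible matrices
that commute with the matrix L_s of left multiplication by s, for every s
[unit_mult_mxP, commute_lmul_mxP].

The hypothesis on the closures enters through a single consequence. The matrices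
commuting with a given matrix B form a linear subspace that is Zariski closed.
If B commutes with T', it therefore commutes with the closure of T', with the
linear combinations of its elements, and so with T [dense_commute].

Now let g normalize T'. Each g A g^-1 with A in T' lies in T, hence commutes
with L_s; equivalently A commutes with g^-1 L_s g. By the previous remark this
extends to all A in T, and g A g^-1 lies in T. The same holds for g^-1, so g
normalizes T.

It remains to see that the normalizer of T in GL(n, R) is T Aut(S/R)
[normalizer_unit_mult_mx]. Since S is additively generated by units, for each a
there is b with g(x a) = g(x) b for all x. This shows first that u = g(1) is a
unit of S, and then that x |-> g(x) u^-1 is multiplicative: if g(x y) = g(x) b
for all x, then g(y) = u b, so g(x y) u^-1 = (g(x) u^-1) (g(y) u^-1). Hence g is
an automorphism followed by right multiplication by u. *)

(** * Commutants are Zariski closed linear subspaces *)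

Section Commutant.
Variables (K : fieldType) (n : nat).
Implicit Types (A B : 'M[K]_n) (X : set 'M[K]_n).

Definition entry_poly (i j : 'I_n) : mpoly (n * n) K :=
  mpolyX K (mnm1 (mxvec_index i j)).

Lemma eval_entry_poly i j A : eval_entries (entry_poly i j) A = A i j.
Proof. by rewrite /eval_entries mevalXU mxvecE. Qed.

Definition commutator_poly B (i j : 'I_n) : mpoly (n * n) K :=
  \sum_k (B k j *: entry_poly i k - B i k *: entry_poly k j).

Lemma eval_commutator_poly B i j A :
  eval_entries (commutator_poly B i j) A = (A *m B - B *m A) i j.
Proof.
rewrite !mxE -sumrB /eval_entries raddf_sum; apply: eq_bigr => k _ /=.
by rewrite raddfB /= !mevalZ -!/(eval_entries _ _) !eval_entry_poly mulrC.
Qed.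

(** The condition A B = B A is a system of linear equations in the entries
of A. *)
Lemma commutant_closed B :
  @closed (zmatrix K n) [set A | A *m B = B *m A].
Proof.
rewrite -openC; exists [set p | exists i j, p = commutator_poly B i j].
rewrite setCK; apply/seteqP; split=> A /=.
  by move=> AB p [i [j ->]]; rewrite eval_commutator_poly AB subrr mxE.
move=> ZA; apply/eqP; rewrite -subr_eq0; apply/eqP/matrixP => i j.
by rewrite -eval_commutator_poly ZA ?mxE //; exists i, j.
Qed.

Lemma commute_lincomb B X : (forall A, X A -> A *m B = B *m A) ->
  forall A, lincomb X A -> A *m B = B *m A.
Proof.
move=> XB A [m [c [x [Xx ->]]]]; rewrite mulmx_suml mulmx_sumr.
by apply: eq_bigr => i _; rewrite -scalemxAl -scalemxAr XB.
Qed.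

Lemma commute_zariski_closure_GL B X : (forall A, X A -> A *m B = B *m A) ->
  forall A, zariski_closure_GL X A -> A *m B = B *m A.
Proof.
move=> XB A [clA _]; have := @commutant_closed B A; apply.
exact: (@closureS (zmatrix K n) X) clA.
Qed.

End Commutant.

(** Commuting with the image of B is a closed linear condition over K, so it
passes from the image of Y to that of X; injectivity of f brings the conclusion
back to R. *)
Lemma dense_commute (R : comUnitRingType) (K : fieldType) (n : nat)
    (f : {rmorphism R -> K}) (X Y : set 'M[R]_n) (B : 'M[R]_n) :
    injective f -> X `<=` [set A | A \in unitmx] ->
    zariski_closure_GL (map_mx f @` X) `<=`
      lincomb (identity_component (zariski_closure_GL (map_mx f @` Y))) ->
    (forall A, Y A -> A *m B = B *m A) ->
  forall A, X A -> A *m B = B *m A.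
Proof.
move=> f_inj X_unit XY YB A XA; apply/matrixP => i j; apply: f_inj.
suff /matrixP/(_ i j) : map_mx f (A *m B) = map_mx f (B *m A) by rewrite !mxE.
rewrite !map_mxM.
have clA : zariski_closure_GL (map_mx f @` X) (map_mx f A).
  split; last by rewrite /= unitmxE det_map_mx rmorph_unit //; exact: X_unit.
  by apply: (@subset_closure (zmatrix K n)); exists A.
apply: commute_lincomb (XY _ clA) => C.
move=> /(@connected_component_sub (zmatrix K n)).
by apply: commute_zariski_closure_GL => _ [D /YB DB <-]; rewrite -!map_mxM DB.
Qed.

(** * Conjugation of sets of matrices *)

Section Conjugation.
Variables (R : comUnitRingType) (n : nat).
Implicit Types (g : 'M[R]_n) (X : set 'M[R]_n).

Lemma conj_set_sub g X :
  conj_set g X `<=` X <-> forall A, X A -> X (g *m A *m invmx g).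
Proof.
split=> [gX A XA|gX _ [A XA <-]]; last exact: gX.
by apply: gX; exists A.
Qed.

Lemma conj_mxK g : g \in unitmx ->
  cancel (fun A => g *m A *m invmx g) (fun A => invmx g *m A *m g).
Proof. by move=> ug A; rewrite !mulmxA mulVmx // mul1mx mulmxKV. Qed.

Lemma conj_set_eqP g X : g \in unitmx -> conj_set g X = X <->
  conj_set g X `<=` X /\ conj_set (invmx g) X `<=` X.
Proof.
move=> ug; split=> [gX|[gX /conj_set_sub gVX]].
  split; first by rewrite gX.
  by rewrite -{1}gX => _ [_ [A XA <-] <-]; rewrite invmxK conj_mxK.
apply/seteqP; split=> // A XA; exists (invmx g *m A *m g).
  by have := gVX _ XA; rewrite invmxK.
by rewrite !mulmxA mulmxV // mul1mx mulmxK.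
Qed.

Lemma invmxM g h : g \in unitmx -> h \in unitmx ->
  invmx (g *m h) = invmx h *m invmx g.
Proof.
move=> ug uh; apply: (can_inj (mulKmx (_ : g *m h \in unitmx))).
  by rewrite unitmx_mul ug.
by rewrite mulmxV ?unitmx_mul ?ug // mulmxA mulmxK // mulmxV.
Qed.

Lemma conj_setM g h X : g \in unitmx -> h \in unitmx ->
  conj_set (g *m h) X = conj_set g (conj_set h X).
Proof.
move=> ug uh; rewrite /conj_set image_comp; apply: eq_imagel => A _ /=.
by rewrite invmxM // !mulmxA.
Qed.

Lemma conj_set_subgroup g X : is_subgroup_GL X -> X g -> conj_set g X = X.
Proof.
move=> [X_unit _ XM XV] Xg; apply/conj_set_eqP; first exact: X_unit.
split; apply/conj_set_sub => A XA; rewrite ?invmxK.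
  exact: XM (XM _ _ Xg XA) (XV _ Xg).
exact: XM (XM _ _ (XV _ Xg) XA) Xg.
Qed.

End Conjugation.

(** * Matrices as endomorphisms of a free algebra *)

Section FreeAlgebra.
Variables (R : idomainType) (S : unitAlgType R) (n : nat) (omega : 'I_n -> S).
Hypothesis basis : is_free_basis omega.
Implicit Types (A B g : 'M[R]_n) (s x y : S).

Definition comb (c : 'cV[R]_n) : S := \sum_i c i 0 *: omega i.

Lemma comb_linear : linear comb.
Proof.
move=> a c d; rewrite /comb scaler_sumr -big_split /=.
by apply: eq_bigr => i _; rewrite !mxE scalerDl scalerA.
Qed.

HB.instance Definition _ :=
  GRing.isLinear.Build R 'cV[R]_n S _ comb comb_linear.

Lemma comb_bij : exists coord, cancel coord comb /\ cancel comb coord.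
Proof.
have coordP x : exists c, comb c = x.
  have [c [cx _]] := basis x; exists (trmx c); rewrite [RHS]cx.
  by apply: eq_bigr => i _; rewrite mxE.
exists (fun x => projT1 (cid (coordP x))).
have coordK x : comb (projT1 (cid (coordP x))) = x by case: cid.
split=> // c; set d := projT1 _; have dc : comb d = comb c by exact: coordK.
have [e [_ e_uniq]] := basis (comb c).
have eE c' : comb c' = comb c -> e = trmx c'.
  move=> c'c; apply: e_uniq; rewrite -c'c.
  by apply: eq_bigr => i _; rewrite mxE.
by apply: trmx_inj; rewrite -!eE.
Qed.

Definition coord : S -> 'cV[R]_n := projT1 (cid comb_bij).

Lemma coordK : cancel coord comb.
Proof. by rewrite /coord; case: cid => ? []. Qed.

Lemma combK : cancel comb coord.
Proof. by rewrite /coord; case: cid => ? []. Qed.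

Definition act A x : S := comb (A *m coord x).

Lemma act_linear A : linear (act A).
Proof.
move=> a x y; rewrite /act -linearP; congr comb.
rewrite scalemxAr -mulmxDr; congr (_ *m _).
by apply: (can_inj combK); rewrite coordK linearP /= !coordK.
Qed.

HB.instance Definition _ A :=
  GRing.isLinear.Build R S S _ (act A) (act_linear A).

Lemma act1 x : act 1%:M x = x.
Proof. by rewrite /act mul1mx coordK. Qed.

Lemma actM A B x : act (A *m B) x = act A (act B x).
Proof. by rewrite /act combK mulmxA. Qed.

Lemma act_inj A B : act A =1 act B -> A = B.
Proof.
move=> AB; apply/matrixP => i j.
have := AB (comb (delta_mx j 0)); rewrite /act combK -!colE.
by move=> /(can_inj combK)/matrixP/(_ i 0); rewrite !mxE.
Qed.

Lemma actK A : A \in unitmx -> cancel (act A) (act (invmx A)).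
Proof. by move=> uA x; rewrite -actM mulVmx ?act1. Qed.

Lemma actVK A : A \in unitmx -> cancel (act (invmx A)) (act A).
Proof. by move=> uA x; rewrite -actM mulmxV ?act1. Qed.

Lemma unitmx_act A B : cancel (act B) (act A) -> A \in unitmx.
Proof.
move=> AB; apply: (proj1 (@mulmx1_unit _ _ A B _)).
by apply: act_inj => x; rewrite actM AB act1.
Qed.

Lemma comb_delta i : comb (delta_mx i 0) = omega i.
Proof.
rewrite /comb (bigD1 i) //= big1 ?addr0 => [|j ji].
  by rewrite mxE !eqxx scale1r.
by rewrite mxE (negPf ji) scale0r.
Qed.

Lemma act_basis A i : act A (omega i) = \sum_j A j i *: omega j.
Proof.
by rewrite -comb_delta /act combK -colE; apply: eq_bigr => j _; rewrite mxE.
Qed.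

Lemma is_matrix_of_act (f : S -> S) A : linear f ->
  is_matrix_of omega f A <-> f =1 act A.
Proof.
move=> f_lin; split=> [fA x|fA i]; last by rewrite fA act_basis.
pose F := HB.pack_for {linear S -> S} f (GRing.isLinear.Build R S S _ f f_lin).
rewrite -(coordK x) -[f]/(F : S -> S) /comb !linear_sum.
by apply: eq_bigr => i _; rewrite !linearZ /= fA act_basis.
Qed.

Definition mx_of (f : S -> S) : 'M[R]_n :=
  \matrix_(j, i) coord (f (omega i)) j 0.

Lemma act_mx_of (f : S -> S) : linear f -> act (mx_of f) =1 f.
Proof.
move=> f_lin x; apply/esym; move: x; apply/is_matrix_of_act => // i.
by rewrite -[LHS]coordK; apply: eq_bigr => j _; rewrite mxE.
Qed.

(** * The multiplication group and the automorphism group *)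

Lemma mull_linear s : linear (fun x : S => s * x).
Proof. by move=> a x y; rewrite mulrDr scalerAr. Qed.

Lemma mulr_linear s : linear (fun x : S => x * s).
Proof. by move=> a x y; rewrite mulrDl scalerAl. Qed.

Definition lmul_mx s := mx_of (fun x => s * x).

Lemma act_lmul_mx s x : act (lmul_mx s) x = s * x.
Proof. exact: (act_mx_of (mull_linear s)). Qed.

(** Left S-linearity becomes a system of commutation relations, to which
[dense_commute] applies. *)
Lemma commute_lmul_mxP A :
  (forall s x, act A (s * x) = s * act A x) <->
  (forall s, A *m lmul_mx s = lmul_mx s *m A).
Proof.
split=> [Al s|Al s x]; first by apply: act_inj => x; rewrite !actM !act_lmul_mx.
by rewrite -!act_lmul_mx -!actM Al.
Qed.

Notation T := (unit_mult_mx omega).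

Lemma unit_mult_mxE A : T A <->
  exists2 a, a \is a GRing.unit & forall x, act A x = x * a.
Proof.
by split=> -[a ua Aa]; exists a => //;
  [move=> x; apply/esym; move: x|]; apply/(is_matrix_of_act _ (mulr_linear a)).
Qed.

(** An endomorphism of S as a left S-module is right multiplication by the image
of 1; when it is bijective, its inverse is right multiplication by the inverse
of that element. *)
Lemma unit_mult_mxP A : T A <->
  A \in unitmx /\ forall s x, act A (s * x) = s * act A x.
Proof.
split=> [/unit_mult_mxE[a ua Aa]|[uA Al]].
  split=> [|s x]; last by rewrite !Aa mulrA.
  apply: (@unitmx_act _ (mx_of (fun x => x * a^-1))) => x.
  by rewrite Aa (act_mx_of (mulr_linear _)) mulrVK.
have Aa x : act A x = x * act A 1 by rewrite -Al mulr1.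
apply/unit_mult_mxE; exists (act A 1) => //.
have Vl s x : act (invmx A) (s * x) = s * act (invmx A) x.
  by apply: (can_inj (actK uA)); rewrite Al !actVK.
apply/unitrP; exists (act (invmx A) 1); split; first by rewrite -Aa actVK.
by rewrite -Vl mulr1 actK.
Qed.

Notation autmx := (aut_mx omega).

Lemma aut_mxP A : autmx A <->
  [/\ A \in unitmx, act A 1 = 1 & forall x y, act A (x * y) = act A x * act A y].
Proof.
split=> [[phi [[psi phiK psiK] phiR phiA]]|[uA A1 AM]].
  have phi_lin : linear phi.
    move=> a x y; rewrite rmorphD -[a *: x]mul1r -scalerAr scalerAl rmorphM phiR.
    by rewrite mulr_algl.
  have Aphi x : act A x = phi x by apply/esym; move: x; apply/is_matrix_of_act.
  split=> [||x y]; rewrite ?Aphi ?rmorph1 ?rmorphM //.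
  have psi_lin : linear psi.
    by move=> a x y; apply: (can_inj phiK); rewrite phi_lin !psiK.
  apply: (@unitmx_act _ (mx_of psi)) => x.
  by rewrite Aphi act_mx_of.
pose phi := HB.pack_for {rmorphism S -> S} (act A)
  (GRing.isMonoidMorphism.Build S S (act A) (A1, AM)).
exists phi; split=> [|r|]; rewrite /=.
- by exists (act (invmx A)); [apply: actK|apply: actVK].
- by rewrite linearZ /= A1.
- by apply/is_matrix_of_act; [exact: act_linear|].
Qed.

(** * The semidirect product and the normalizer *)

Lemma unit_mult_mx_subgroup : is_subgroup_GL T.
Proof.
split=> [A /unit_mult_mxP[]//||A B /unit_mult_mxP[uA Al] /unit_mult_mxP[uB Bl]|
         A /unit_mult_mxP[uA Al]]; apply/unit_mult_mxP.
- by split=> [|s x]; rewrite ?unitmx1 ?act1.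
- by split=> [|s x]; rewrite ?unitmx_mul ?uA // !actM Bl Al.
- split=> [|s x]; first by rewrite unitmx_inv.
  by apply: (can_inj (actK uA)); rewrite Al !actVK.
Qed.

Lemma aut_mx_subgroup : is_subgroup_GL autmx.
Proof.
split=> [A /aut_mxP[]//||A B /aut_mxP[uA A1 AM] /aut_mxP[uB B1 BM]|
         A /aut_mxP[uA A1 AM]]; apply/aut_mxP.
- by split=> [||x y]; rewrite ?unitmx1 ?act1.
- by split=> [||x y]; rewrite ?unitmx_mul ?uA // !actM ?B1 ?A1 ?BM ?AM.
- split=> [||x y]; first by rewrite unitmx_inv.
    by apply: (can_inj (actK uA)); rewrite A1 actVK.
  by apply: (can_inj (actK uA)); rewrite AM !actVK.
Qed.

(** If phi is an automorphism and f is left S-linear, so is phi f phi^-1,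
because s phi(f(phi^-1 x)) = phi(phi^-1(s) f(phi^-1 x)). *)
Lemma aut_mx_conj A : autmx A -> conj_set A T `<=` T.
Proof.
move=> /aut_mxP[uA A1 AM]; apply/conj_set_sub => B /unit_mult_mxP[uB Bl].
apply/unit_mult_mxP; split=> [|s x].
  by rewrite !unitmx_mul uA uB unitmx_inv.
have VM : act (invmx A) (s * x) = act (invmx A) s * act (invmx A) x.
  by apply: (can_inj (actK uA)); rewrite AM !actVK.
by rewrite !actM VM Bl AM actVK.
Qed.

(** The intersection is trivial because a right multiplication fixing 1 is the
identity. *)
Lemma unit_mult_aut_semidirect : is_semidirect T autmx.
Proof.
have [_ _ _ autV] := aut_mx_subgroup.
split; [exact: unit_mult_mx_subgroup|exact: aut_mx_subgroup| |].
  move=> A autA; have /aut_mxP[uA _ _] := autA; apply/(conj_set_eqP _ uA).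
  by split; apply: aut_mx_conj => //; apply: autV.
apply/seteqP; split=> [A [/unit_mult_mxP[uA Al] /aut_mxP[_ A1 _]]|_ ->].
  by apply: act_inj => x; rewrite -[x]mulr1 Al A1 act1.
by split; [case: unit_mult_mx_subgroup|case: aut_mx_subgroup].
Qed.

(** For a unit a such a b exists because g conjugates right multiplication by a
to an element of T. The elements a that admit some b form an additive subgroup,
which is therefore S. *)
Lemma conj_unit_mult_twist g : unit_generated S -> g \in unitmx ->
  conj_set g T `<=` T ->
  forall a, exists b, forall x, act g (x * a) = act g x * b.
Proof.
move=> S_gen ug /conj_set_sub gT.
apply: S_gen => [|a c [b gab] [d gcd]|a ua].
- by exists 0 => x; rewrite !mulr0 linear0.
- by exists (b - d) => x; rewrite !mulrBr linearB /= gab gcd.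
have Aa := act_mx_of (mulr_linear a).
have /gT/unit_mult_mxE[b _ gab] : T (mx_of (fun x => x * a)).
  by apply/unit_mult_mxE; exists a.
by exists b => x; rewrite -gab !actM actK // Aa.
Qed.

(** If g normalizes T, then u = g(1) is a unit, the map x |-> g(x) u^-1 is an
automorphism, and g is this map followed by right multiplication by u. *)
Lemma normalizer_unit_mult_mx : unit_generated S ->
  normalizer_in [set A | A \in unitmx] T = prod_set T autmx.
Proof.
move=> S_gen; apply/seteqP; split=> g; last first.
  move=> [A [B [TA autB ->]]].
  have [T_unit _ _ _] := unit_mult_mx_subgroup.
  have [_ _ autT _] := unit_mult_aut_semidirect.
  have uA := T_unit _ TA; have /aut_mxP[uB _ _] := autB.
  split; first by rewrite /= unitmx_mul uA.
  rewrite conj_setM // autT // conj_set_subgroup //.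
  exact: unit_mult_mx_subgroup.
move=> [/= ug /(conj_set_eqP _ ug)[gT gVT]].
have twist := conj_unit_mult_twist S_gen ug gT.
have uV : invmx g \in unitmx by rewrite unitmx_inv.
have Vtwist := conj_unit_mult_twist S_gen uV gVT.
set u := act g 1.
(* Multiplication by b on the right corresponds under g^-1 to multiplication
   by some a, and evaluating at u gives a = g^-1(u b). *)
have u_cancel b : u * b = 0 -> b = 0.
  have [a gVab] := Vtwist b => ub0.
  have a0 : a = 0 by have := gVab u; rewrite ub0 linear0 actK // mul1r.
  by apply: (can_inj (actVK ug)); rewrite -[b]mul1r gVab a0 mulr0 linear0.
(* Surjectivity of g gives a right inverse of u, and cancellation makes it
   two-sided. *)
have [v gv] := twist (act (invmx g) 1).
have uv : u * v = 1 by rewrite -gv mul1r actVK.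
have vu : v * u = 1.
  apply/eqP; rewrite -subr_eq0; apply/eqP/u_cancel.
  by rewrite mulrBr mulrA uv mul1r mulr1 subrr.
have uu : u \is a GRing.unit by apply/unitrP; exists v.
have TA : T (mx_of (fun x => x * u)).
  by apply/unit_mult_mxE; exists u => // x; rewrite (act_mx_of (mulr_linear u)).
have /unit_mult_mxP[uA _] := TA; set A := mx_of _ in TA uA.
exists A, (invmx A *m g); split; rewrite ?mulKVmx //.
have VgE x : act (invmx A *m g) x = act g x * v.
  rewrite actM; apply: (can_inj (actK uA)); rewrite actVK //.
  by rewrite (act_mx_of (mulr_linear u)) -mulrA vu mulr1.
apply/aut_mxP; split=> [||x y].
- by rewrite unitmx_mul unitmx_inv uA.
- by rewrite VgE.
have [b gb] := twist y.
have -> : act (invmx A *m g) y = u * b * v by rewrite VgE -gb mul1r.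
by rewrite !VgE gb !mulrA -(mulrA _ v) vu mulr1.
Qed.

End FreeAlgebra.

Theorem theorem3p5
  (R : idomainType) (S : unitAlgType R)
  (R_subring : injective (fun r : R => r%:A : S))
  (n : nat) (omega : 'I_n -> S) (omega_basis : is_free_basis omega)
  (S_gen : unit_generated S)
  (K : closedFieldType) (iota : {rmorphism {fraction R} -> K})
  (K_closure : is_algebraic_closure iota)
  (G' : set 'M[R]_n) (G'_subgroup : is_subgroup_GL G') :
  let T := unit_mult_mx omega in
  let T' := T `&` G' in
  let zcl (X : set 'M[R]_n) : set 'M[K]_n :=
    zariski_closure_GL [set map_mx (fun r : R => iota (tofrac r)) A | A in X] in
  zcl T `<=` lincomb (identity_component (zcl T')) ->
  is_semidirect T (aut_mx omega) /\
  normalizer_in G' T' = prod_set T (aut_mx omega) `&` G'.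
Proof.
move=> T T' zcl dense; split; first exact: unit_mult_aut_semidirect.
rewrite -normalizer_unit_mult_mx //.
have [G'_unit _ G'M G'V] := G'_subgroup.
have [T_unit _ _ _] := unit_mult_mx_subgroup omega_basis.
(* The matrix g^-1 L g commutes with T', hence with T; conjugating by g turns
   this into the statement that g A g^-1 commutes with L. *)
have conjT g : g \in unitmx -> conj_set g T' `<=` T' -> conj_set g T `<=` T.
  move=> ug /conj_set_sub gT'; apply/conj_set_sub => A TA.
  apply/(unit_mult_mxP omega_basis); split.
    by rewrite !unitmx_mul ug unitmx_inv ug T_unit.
  apply/commute_lmul_mxP => s; set L := lmul_mx _ s.
  have TL B : T B -> B *m L = L *m B.
    by move=> /(unit_mult_mxP omega_basis)[_ /commute_lmul_mxP]; apply.
  have conjL B : (g *m B *m invmx g) *m L = L *m (g *m B *m invmx g) <->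
      B *m (invmx g *m L *m g) = (invmx g *m L *m g) *m B.
    split=> [/(congr1 (fun C => invmx g *m C *m g))|
             /(congr1 (fun C => g *m C *m invmx g))].
      by rewrite !mulmxA mulVmx // mul1mx mulmxKV.
    by rewrite !mulmxA mulmxV // mul1mx mulmxK.
  pose f : {rmorphism R -> K} := iota \o @tofrac R.
  have f_inj : injective f.
    by move=> x y /fmorph_inj /eqP; rewrite tofrac_eq => /eqP.
  apply/conjL; apply: (dense_commute f_inj T_unit dense _ TA) => B T'B.
  by apply/conjL/TL; have [] := gT' _ T'B.
apply/seteqP; split=> g.
  move=> [G'g]; have ug := G'_unit _ G'g.
  move=> /(conj_set_eqP _ ug)[gT' gVT']; split=> //; split=> //.
  by apply/(conj_set_eqP _ ug); split; apply: conjT; rewrite ?unitmx_inv.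
move=> [[ug /(conj_set_eqP _ ug)[/conj_set_sub gT /conj_set_sub gVT]] G'g].
have conjT' h : G' h -> (forall A, T A -> T (h *m A *m invmx h)) ->
    conj_set h T' `<=` T'.
  move=> G'h hT; apply/conj_set_sub => A [TA G'A]; split; first exact: hT.
  exact: G'M (G'M _ _ G'h G'A) (G'V _ G'h).
split=> //; apply/(conj_set_eqP _ ug); split; apply: conjT' => //.
exact: G'V.
Qed.
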